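(* Let $I = \{(i,j) : i,j \in \mathcal{A},\ i<j\}$, where $\mathcal{A}$ is the set of positive integers. The map $\phi : \mathsf{hypo} \to \prod_{I} \mathsf{hypo}_2$ whose $(i,j)$-th component, for $(i,j) \in I$, is given by $[w]_{\mathsf{hypo}} \mapsto \varphi_{ij}([w]_{\mathsf{hypo}})$ ($w \in \mathcal{A}^*$), is an embedding (injective monoid homomorphism).
   Context: Let $\mathcal{A} = \{1<2<3<\cdots\}$ be the ordered alphabet of positive integers and $\mathcal{A}_n = \{1<\cdots<n\}$. For a word $w$, $|w|_a$ is the number of occurrences of the letter $a$; the content of $w$ is the tuple $(|w|_a)_a$, and the support $\mathrm{supp}(w)$ is the set of letters occurring in $w$. A quasi-ribbon tableau is a finite grid of cells, aligned so that the leftmost cell in each row is below the rightmost cell of the previous row, filled with letters of $\mathcal{A}$ so that rows weakly increase from left to right and columns strictly increase from top to bottom. Krob--Thibon insertion of a letter $a$ into a quasi-ribbon tableau $T$: if no entry of $T$ is $\le a$, create a new cell $a$ and glue $T$ by its top-leftmost entry to the bottom of this cell; otherwise, let $x$ be the right-most and bottom-most entry of $T$ with $x \le a$, separate $T$ just after $x$, put a new entry $a$ to the right of $x$ and glue the remaining part of $T$ (below and to the right of $x$) onto the bottom of the new entry $a$. For $u \in \mathcal{A}^*$, $\mathrm{P}_{\mathsf{hypo}}(u)$ is the tableau obtained from the empty tableau by inserting the letters of $u$ from left to right. The hypoplactic congruence is: $u \equiv_{\mathsf{hypo}} v$ iff $\mathrm{P}_{\mathsf{hypo}}(u) = \mathrm{P}_{\mathsf{hypo}}(v)$.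 The hypoplactic monoid is $\mathsf{hypo} = \mathcal{A}^*/{\equiv_{\mathsf{hypo}}}$, and the hypoplactic monoid of rank $n$ is $\mathsf{hypo}_n = \mathcal{A}_n^*/{\equiv_{\mathsf{hypo}}}$; classes are written $[u]_{\mathsf{hypo}}$, $[u]_{\mathsf{hypo}_n}$. Known equivalent description (Novelli): $u \equiv_{\mathsf{hypo}} v$ iff $u$ and $v$ have the same content and the same inversions, where, if $\mathrm{supp}(u) = \{a_1<\dots<a_k\}$, $u$ has an $a_{i+1}$-$a_i$ inversion ($1 \le i \le k-1$) iff $a_{i+1}a_i$ is a (scattered) subsequence of $u$. For $i<j$ in $\mathcal{A}$, let $\varphi_{ij}: \mathcal{A}^* \to \mathsf{hypo}_2$ be the monoid homomorphism with $\varphi_{ij}(i) = [1]_{\mathsf{hypo}_2}$, $\varphi_{ij}(j) = [2]_{\mathsf{hypo}_2}$, $\varphi_{ij}(a) = [21]_{\mathsf{hypo}_2}$ if $i<a<j$, and $\varphi_{ij}(a) = [\varepsilon]_{\mathsf{hypo}_2}$ otherwise ($\varepsilon$ is the empty word). It factors through $\equiv_{\mathsf{hypo}}$ to a homomorphism $\mathsf{hypo} \to \mathsf{hypo}_2$, also denoted $\varphi_{ij}$. *)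

(* Defs.v *)
From HB Require Import structures.
From mathcomp Require Import all_boot all_order.
From mathcomp Require Import boolp.

Set Warnings "-redundant-canonical-projection".

Set Implicit Arguments.
Unset Strict Implicit.
Unset Printing Implicit Defensive.

Import Order.TTheory.

Local Open Scope order_scope.
Local Open Scope quotient_scope.
Local Open Scope group_scope.

HB.instance Definition _ (T : choiceType) :=
  isMonoid.Build (seq T) (@catA T) (@cat0s T) (@cats0 T).

Section ProductMonoid.
Variables (I : Type) (M : I -> monoidType).

Definition prodm : Type := forall i, M i.
HB.instance Definition _ := Choice.copy prodm (forall i, M i).

Definition prodm_mul (x y : prodm) : prodm := fun i => x i * y i.
Definition prodm_one : prodm := fun=> 1.

Lemma prodm_mulA : associative prodm_mul.
Proof. by move=> x y z; apply: functional_extensionality_dep => i; exact: mulgA. Qed.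
Lemma prodm_mul1 : left_id prodm_one prodm_mul.
Proof. by move=> x; apply: functional_extensionality_dep => i; exact: mul1g. Qed.
Lemma prodm_1mul : right_id prodm_one prodm_mul.
Proof. by move=> x; apply: functional_extensionality_dep => i; exact: mulg1. Qed.

HB.instance Definition _ := isMonoid.Build prodm prodm_mulA prodm_mul1 prodm_1mul.
End ProductMonoid.

(* A totally ordered alphabet A is kept abstract, so that the same construction
   gives both hypo (all positive integers) and hypo_n (the letters 1, ..., n). *)
Section Hypoplactic.
Variables (d : Order.disp_t) (A : orderType d).
Implicit Types (a b c x y : A) (u v w s : seq A) (T : seq (seq A)).

(* A tableau is the list of its rows from top to bottom. In a quasi-ribbon
   tableau the leftmost cell of each row lies below the rightmost cell of the
   previous one, so the shape is determined by the row lengths and the only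
   columns with more than one cell are formed by such pairs of cells (and by
   their chaining through rows of length one). *)
Fixpoint quasi_ribbon T : bool :=
  match T with
  | [::] => true
  | [::] :: _ => false
  | (x :: r) :: T' =>
      [&& sorted <=%O (x :: r),
          (if T' is (y :: _) :: _ then last x r < y else true)
        & quasi_ribbon T']
  end.

(* Krob-Thibon insertion. Along a quasi-ribbon tableau entries weakly increase,
   so that the last entry x <= a lies in the last row containing an entry <= a,
   and in that row r the entries up to x are [seq y <- r | y <= a]. When there
   is no such x the formula below (reached in the top row) creates the row [a]
   on top of the tableau. *)
Fixpoint kt_insert T a : seq (seq A) :=
  if T is r :: T' then
    if has (fun y => y <= a) (flatten T') then r :: kt_insert T' a
    else let rest := [seq y <- r | a < y] in
         rcons [seq y <- r | y <= a] a :: (if nilp rest then T' else rest :: T')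
  else [:: [:: a]].

Definition P_hypo u : seq (seq A) := foldl kt_insert [::] u.

Definition hypo_eq u v : bool := P_hypo u == P_hypo v.

Lemma hypo_eq_refl : reflexive hypo_eq.
Proof. by move=> u; rewrite /hypo_eq. Qed.
Lemma hypo_eq_sym : symmetric hypo_eq.
Proof. by move=> u v; rewrite /hypo_eq eq_sym. Qed.
Lemma hypo_eq_trans : transitive hypo_eq.
Proof. by move=> v u w /eqP uv /eqP vw; rewrite /hypo_eq uv vw. Qed.

Canonical hypo_equiv := EquivRel hypo_eq hypo_eq_refl hypo_eq_sym hypo_eq_trans.

Definition hypo : Type := {eq_quot hypo_equiv}.
HB.instance Definition _ := EqQuotient.on hypo.
HB.instance Definition _ := Choice.on hypo.

Lemma hypo_piP u v : reflect (P_hypo u = P_hypo v) (u == v %[mod hypo])%qT.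
Proof. by rewrite (eqmodE hypo_equiv); exact: eqP. Qed.

(* P_hypo u cuts the sorted rearrangement of u between consecutive letters b < c
   exactly when u has a c-b inversion. *)

Definition inversion u b c : bool := (b < c) && subseq [:: c; b] u.

Fixpoint cut (brk : rel A) x s : seq (seq A) :=
  if s is y :: s' then
    if brk x y then [:: x] :: cut brk y s'
    else (x :: head [::] (cut brk y s')) :: behead (cut brk y s')
  else [:: [:: x]].

Definition cuts brk s : seq (seq A) := if s is x :: s' then cut brk x s' else [::].

Lemma cut_neq0 brk x s : exists r T, cut brk x s = (x :: r) :: T.
Proof.
case: s => [|y s] /=; first by exists [::], [::].
by case: ifP => _; eexists; eexists.
Qed.

Lemma flatten_cut brk x s : flatten (cut brk x s) = x :: s.
Proof.
elim: s x => [//|y s IH] x /=; case: ifP => _ /=; first by rewrite IH.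
by have [r [T E]] := cut_neq0 brk y s; move: (IH y); rewrite E /= => ->.
Qed.

Lemma flatten_cuts brk s : flatten (cuts brk s) = s.
Proof. by case: s => //= x s; exact: flatten_cut. Qed.

Lemma eq_cut brk brk' x s :
  {in x :: s &, brk =2 brk'} -> cut brk x s = cut brk' x s.
Proof.
elim: s x => [//|y s IH] x H /=.
rewrite (H x y) ?inE ?eqxx ?orbT // (IH y) // => z t zs ts.
by apply: H; rewrite inE ?zs ?ts orbT.
Qed.

Lemma has_gt a s : all (fun y => a < y) s -> has (fun y => y <= a) s = false.
Proof. by elim: s => //= y s IH /andP[ay /IH ->]; rewrite leNgt ay. Qed.

Lemma filter_le_gt a s : all (fun y => a < y) s -> [seq y <- s | y <= a] = [::].
Proof. by elim: s => //= y s IH /andP[ay /IH ->]; rewrite leNgt ay. Qed.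

Lemma filter_gt_le a s : all (fun y => y <= a) s -> [seq y <- s | a < y] = [::].
Proof. by elim: s => //= y s IH /andP[ay /IH ->]; rewrite ltNge ay. Qed.

Lemma kt_insert_cons r T a : has (fun y => y <= a) (flatten T) ->
  kt_insert (r :: T) a = r :: kt_insert T a.
Proof. by move=> /= ->. Qed.

Lemma kt_insert_gt T a : all (fun y => a < y) (flatten T) -> [::] \notin T ->
  kt_insert T a = [:: a] :: T.
Proof.
case: T => [//|r T] /=; rewrite all_cat inE negb_or => /andP[ar aT] /andP[r0 _].
rewrite (has_gt aT) (filter_le_gt ar) /=; move/all_filterP: ar => ->.
by case: r r0.
Qed.

Lemma cut_nil brk x s : [::] \notin cut brk x s.
Proof.
elim: s x => [//|y s IH] x /=; case: ifP => _; rewrite inE negb_or ?IH //=.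
by have [r [T E]] := cut_neq0 brk y s; move: (IH y); rewrite E inE negb_or /= .
Qed.

(* Prepending an entry to the first row commutes with insertion when the entry
   and some entry of the tableau are <= a. *)
Lemma kt_insert_head x y r T a : x <= a -> y <= a ->
  kt_insert ((x :: y :: r) :: T) a =
  (x :: head [::] (kt_insert ((y :: r) :: T) a))
     :: behead (kt_insert ((y :: r) :: T) a).
Proof.
move=> xa ya /=; case: ifP => //= _.
by rewrite xa ya !ltNge xa ya.
Qed.

Lemma kt_insert_cut brk brk' x s1 s2 a :
  all (fun y => y <= a) (x :: s1) -> all (fun y => a < y) s2 ->
  {in x :: s1 &, brk =2 brk'} -> {in s2 &, brk =2 brk'} ->
  brk' (last x s1) a = false -> (forall y, y \in s2 -> brk' a y) ->
  kt_insert (cut brk x (s1 ++ s2)) a = cut brk' x (s1 ++ a :: s2).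
Proof.
elim: s1 x => [|y s1 IH] x /=.
  rewrite andbT => xa s2a _ e2 xab aby; rewrite xab.
  case: s2 s2a e2 aby => [|z s2] s2a e2 aby /=.
    by rewrite xa ltNge xa.
  have bz : brk' a z by apply: aby; rewrite inE eqxx.
  rewrite bz -(eq_cut e2) /=.
  have [r [T E]] := cut_neq0 brk z s2.
  have := flatten_cut brk z s2; rewrite E /= => -[Er].
  move: s2a; rewrite -Er /= all_cat => /and3P[az ar aT].
  case: ifP => _ /=; last first.
    rewrite (has_gt aT) xa ltNge xa /= leNgt az /= (filter_le_gt ar) /=.
    by move/all_filterP: (ar) => ->.
  rewrite has_cat (has_gt aT) (has_gt ar) leNgt az /=.
  by rewrite xa /= ltNge xa.
move=> /and3P[xa ya s1a] s2a e1 e2 lb aby.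
have IHy : kt_insert (cut brk y (s1 ++ s2)) a = cut brk' y (s1 ++ a :: s2).
  apply: IH => //=; first by rewrite ya.
  by move=> z t zs ts; apply: e1; rewrite inE ?zs ?ts orbT.
rewrite -(e1 x y) ?inE ?eqxx ?orbT // -IHy; case: ifP => _.
  by rewrite kt_insert_cons // flatten_cut /= ya.
have [r [T ->]] := cut_neq0 brk y (s1 ++ s2).
by rewrite /= -(kt_insert_head r T xa ya).
Qed.

Lemma kt_insert_cuts brk brk' s1 s2 a :
  all (fun y => y <= a) s1 -> all (fun y => a < y) s2 ->
  {in s1 &, brk =2 brk'} -> {in s2 &, brk =2 brk'} ->
  brk' (last a s1) a = false -> (forall y, y \in s2 -> brk' a y) ->
  kt_insert (cuts brk (s1 ++ s2)) a = cuts brk' (s1 ++ a :: s2).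
Proof.
case: s1 => [|x s1] s1a s2a e1 e2 b1 b2 /=; last first.
  exact: kt_insert_cut.
case: s2 s2a e2 b2 {s1a e1 b1} => [//|z s2] s2a e2 b2 /=.
rewrite b2 ?inE ?eqxx // -(eq_cut e2) kt_insert_gt ?flatten_cut //.
exact: cut_nil.
Qed.

Lemma subseq2_rcons b c a u :
  subseq [:: c; b] (rcons u a) = subseq [:: c; b] u || (b == a) && (c \in u).
Proof.
elim: u => [|x u IH] /=.
  by rewrite andbF; case: ifP => // _; case: ifP.
rewrite inE; case: (eqVneq c x) => [->|_] //=.
by rewrite !sub1seq mem_rcons inE orbC andbT.
Qed.

Lemma sort_split u a :
  sort <=%O u = [seq x <- sort <=%O u | x <= a] ++ [seq x <- sort <=%O u | a < x].
Proof.
elim: (sort _ u) (sort_le_sorted u) => [//|x s IH] /= px.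
have ps := path_sorted px; case: leP => [xa|ax] /=; first by rewrite -IH.
have sa : all (fun y => a < y) s.
  apply: sub_all (order_path_min le_trans px) => y xy; exact: lt_le_trans ax xy.
by rewrite (filter_le_gt sa); move/all_filterP: sa => ->.
Qed.

Lemma P_hypoE u : P_hypo u = cuts (inversion u) (sort <=%O u).
Proof.
elim/last_ind: u => [//|u a IH].
rewrite /P_hypo foldl_rcons -/(P_hypo u) IH {IH} (sort_split u a).
set s1 := [seq x <- _ | x <= a]; set s2 := [seq x <- _ | a < x].
have s1P y : y \in s1 = (y <= a) && (y \in u) by rewrite mem_filter mem_sort.
have s2P y : y \in s2 = (a < y) && (y \in u) by rewrite mem_filter mem_sort.
have -> : sort <=%O (rcons u a) = s1 ++ a :: s2.
  apply: (sorted_eq le_trans le_anti) => [||].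
  - exact: sort_le_sorted.
  - have pw (p : pred A) : pairwise <=%O [seq x <- sort <=%O u | p x].
      by rewrite -(sorted_pairwise le_trans) (sorted_filter le_trans) ?sort_le_sorted.
    rewrite (sorted_pairwise le_trans) pairwise_cat /= !pw !andbT.
    apply/andP; split; last by apply/allP => y; rewrite s2P => /andP[/ltW].
    apply/allrelP => y z; rewrite s1P inE => /andP[ya _] /predU1P[-> //|].
    by rewrite s2P => /andP[az _]; exact: le_trans ya (ltW az).
  - rewrite perm_sort perm_rcons perm_sym -cat1s perm_catCA cat1s perm_cons.
    by rewrite -sort_split perm_sort.
apply: kt_insert_cuts.
- by apply/allP => y; rewrite s1P => /andP[].
- by apply/allP => y; rewrite s2P => /andP[].
- move=> b c; rewrite !s1P => /andP[ba bu] /andP[ca cu].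
  rewrite /inversion subseq2_rcons; case: (ltP b c) => //= bc.
  by rewrite (lt_eqF (lt_le_trans bc ca)) orbF.
- move=> b c; rewrite !s2P => /andP[ab bu] /andP[ac cu].
  by rewrite /inversion subseq2_rcons (gt_eqF ab) orbF.
- rewrite /inversion subseq2_rcons; case: ltP => //= la; rewrite (lt_eqF la) orbF.
  apply/negbTE/negP => /mem_subseq/(_ a); rewrite inE eqxx => /(_ isT) au.
  have : a \in s1 by rewrite s1P lexx.
  have : sorted <=%O s1 by rewrite (sorted_filter le_trans) ?sort_le_sorted.
  case/lastP: s1 la {s1P} => [//|s1 l]; rewrite last_rcons => la.
  rewrite (sorted_pairwise le_trans) -cats1 pairwise_cat => /andP[/allrelP H _].
  rewrite mem_cat inE (gt_eqF la) orbF => /H/(_ (mem_head _ _)).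
  by rewrite leNgt la.
- move=> y; rewrite s2P => /andP[ay yu].
  by rewrite /inversion subseq2_rcons ay eqxx yu orbT.
Qed.

Definition consecutive u b c : Prop :=
  [/\ b \in u, c \in u, b < c & forall x, x \in u -> ~~ (b < x < c)].

Lemma cut_inj brk brk' x s :
  cut brk x s = cut brk' x s <-> path (fun y z => brk y z == brk' y z) x s.
Proof.
elim: s x => [//|y s IH] x /=.
have [r [T E]] := cut_neq0 brk y s; have [r' [T' E']] := cut_neq0 brk' y s.
move: (IH y); rewrite E E' /= => {}IH.
by case: (brk x y); case: (brk' x y) => /=;
   split=> //; (by case=> e1 e2; apply/IH; rewrite e1 e2) || move/IH=> [-> ->].
Qed.

Lemma sorted_consecutive (R : rel A) s : reflexive R -> sorted <=%O s ->
  sorted R s <-> (forall b c, consecutive s b c -> R b c).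
Proof.
move=> Rxx; case: s => [_|x s /=]; first by split => // _ b c [].
elim: s x => [|y s IH] x.
  by move=> _; split=> // _ b c; case; rewrite !inE => /eqP-> /eqP->; rewrite ltxx.
move=> sxy; have xall := order_path_min le_trans sxy.
move: sxy; rewrite /= => /andP[xy ys].
have yall := order_path_min le_trans ys.
have {}IH := IH y ys; split=> [/andP[Rxy /IH HR] b c [bs cs bc nb]|H].
  have ct : c \in y :: s.
    move: cs; rewrite inE => /predU1P[cx|//]; move: bs; rewrite inE.
    case/predU1P=> [bx|/(allP xall) xb]; first by rewrite bx cx ltxx in bc.
    by rewrite cx ltNge xb in bc.
  case bt : (b \in y :: s).
    by apply: HR; split=> // z zs; apply: nb; rewrite inE zs orbT.
  move: bs; rewrite inE bt orbF => /eqP bx; subst b.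
  have ltxy : x < y.
    by rewrite lt_neqAle xy andbT; apply: contraFneq bt => ->; rewrite mem_head.
  have := nb y; rewrite !inE eqxx orbT ltxy /= -leNgt => /(_ isT) cy.
  suff -> : c = y by [].
  apply/le_anti; rewrite cy /=; move: ct; rewrite inE => /predU1P[-> //|].
  exact: (allP yall).
apply/andP; split.
  move: xy; rewrite le_eqVlt => /predU1P[-> //|xy].
  apply: H; split; rewrite ?inE ?eqxx ?orbT // => z.
  rewrite !inE => /or3P[/eqP->|/eqP->|/(allP yall) yz]; rewrite ?ltxx ?andbF //.
  by rewrite (ltNge z) yz andbF.
apply/IH => b c [bs cs bc nb]; apply: H; split; rewrite 1?inE ?bs ?cs ?orbT //.
move=> z; rewrite inE => /predU1P[->|]; last exact: nb.
by rewrite ltNge (allP xall).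
Qed.

(* Novelli's description of the hypoplactic congruence. *)
Lemma hypo_novelli u v : P_hypo u = P_hypo v <->
  perm_eq u v /\
  (forall b c, consecutive u b c -> subseq [:: c; b] u = subseq [:: c; b] v).
Proof.
pose R : rel A := fun b c => inversion u b c == inversion v b c.
have Rxx : reflexive R by move=> x; rewrite /R /inversion ltxx eqxx.
have cutsR s : cuts (inversion u) s = cuts (inversion v) s <-> sorted R s.
  by case: s => //= x s; exact: cut_inj.
have consE b c : consecutive (sort <=%O u) b c <-> consecutive u b c.
  rewrite /consecutive !mem_sort.
  by split=> -[? ? ? H]; split=> // z zu; apply: H; rewrite mem_sort in zu *.
have RE b c : b < c -> R b c = (subseq [:: c; b] u == subseq [:: c; b] v).
  by rewrite /R /inversion => ->.
have main : sorted R (sort <=%O u) <->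
   (forall b c, consecutive u b c -> subseq [:: c; b] u = subseq [:: c; b] v).
  rewrite (sorted_consecutive Rxx) ?sort_le_sorted //; split=> H b c bc.
    by have [_ _ ltbc _] := bc; apply/eqP; rewrite -RE //; apply: H; apply/consE.
  by move/consE: bc => bc; have [_ _ ltbc _] := bc; rewrite RE // H.
rewrite !P_hypoE; split=> [E|[uv H]].
  have su : sort <=%O u = sort <=%O v.
    by rewrite -(flatten_cuts (inversion u) (sort _ u)) E flatten_cuts.
  split; last by apply/main/cutsR; rewrite E su.
  by apply/(perm_sortP le_total le_trans le_anti).
have <- : sort <=%O u = sort <=%O v.
  by apply/(perm_sortP le_total le_trans le_anti).
exact/cutsR/main.
Qed.

Lemma quasi_ribbon_cut x s (brk : rel A) : path <=%O x s ->
  (forall b c, brk b c -> b < c) -> quasi_ribbon (cut brk x s).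
Proof.
move=> + brkP; elim: s x => [//|y s IH] x /= /andP[xy /IH {IH}].
have [r [T ->]] := cut_neq0 brk y s.
by case: ifP => [/brkP ltxy|_] /= /and3P[-> -> ->]; rewrite ?ltxy ?xy.
Qed.

Lemma P_hypo_quasi_ribbon u : quasi_ribbon (P_hypo u).
Proof.
rewrite P_hypoE; move: (sort_le_sorted u); case: (sort _ u) => //= x s sx.
by apply: quasi_ribbon_cut => // b c /andP[].
Qed.

Lemma subseq2_cat b c u v :
  subseq [:: c; b] (u ++ v) =
  [|| subseq [:: c; b] u, subseq [:: c; b] v | (c \in u) && (b \in v)].
Proof.
elim/last_ind: v => [|v a IH].
  by rewrite cats0 in_nil andbF !orbF.
rewrite -rcons_cat !subseq2_rcons IH mem_cat mem_rcons inE.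
by do ![case: (_ \in _) | case: subseq | case: (_ == _)].
Qed.

Lemma subseq2_mem b c u : subseq [:: c; b] u -> (b \in u) && (c \in u).
Proof.
by move/mem_subseq => H; rewrite !H // !inE eqxx ?orbT.
Qed.

Lemma hypo_eq_cat u u' v v' :
  P_hypo u = P_hypo u' -> P_hypo v = P_hypo v' -> P_hypo (u ++ v) = P_hypo (u' ++ v').
Proof.
move=> + /hypo_novelli[pv Hv]; rewrite /P_hypo !foldl_cat => ->.
rewrite -!foldl_cat -!/(P_hypo _); apply/hypo_novelli.
rewrite perm_cat2l; split=> // b c [_ _ bc nb].
rewrite !subseq2_cat -(perm_mem pv b).
suff -> : subseq [:: c; b] v = subseq [:: c; b] v' by [].
case bv : ((b \in v) && (c \in v)).
  have /andP[{}bv cv] := bv; apply: Hv; split=> // x xv.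
  by apply: nb; rewrite mem_cat xv orbT.
have bv' := bv; rewrite (perm_mem pv b) (perm_mem pv c) in bv'.
by rewrite !(contraFF (@subseq2_mem b c _)).
Qed.

Definition hypo_mul (x y : hypo) : hypo := \pi_hypo (repr x ++ repr y).
Definition hypo_one : hypo := \pi_hypo [::].

Lemma P_hypo_repr u : P_hypo (repr (\pi_hypo u)) = P_hypo u.
Proof. by apply/hypo_piP; rewrite reprK. Qed.

Lemma hypo_pi_mul u v : hypo_mul (\pi_hypo u) (\pi_hypo v) = \pi_hypo (u ++ v).
Proof. by apply/eqP/hypo_piP; apply: hypo_eq_cat; exact: P_hypo_repr. Qed.

Lemma hypo_mulA : associative hypo_mul.
Proof.
elim/quotW=> u; elim/quotW=> v; elim/quotW=> w.
rewrite (hypo_pi_mul v w) (hypo_pi_mul u v) (hypo_pi_mul u (v ++ w)).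
by rewrite (hypo_pi_mul (u ++ v) w) catA.
Qed.
Lemma hypo_mul1 : left_id hypo_one hypo_mul.
Proof. by elim/quotW=> u; rewrite (hypo_pi_mul [::] u). Qed.
Lemma hypo_1mul : right_id hypo_one hypo_mul.
Proof. by elim/quotW=> u; rewrite (hypo_pi_mul u [::]) cats0. Qed.

HB.instance Definition _ := isMonoid.Build hypo hypo_mulA hypo_mul1 hypo_1mul.

Lemma hypo_pi_monoid_morphism : monoid_morphism (\pi_hypo : seq A -> hypo).
Proof. by split=> // u v; exact: esym (hypo_pi_mul u v). Qed.

End Hypoplactic.

Arguments hypo {d} A.

Record letter := Letter { letter_val :> nat; _ : (0 < letter_val)%N }.
HB.instance Definition _ := [isSub for letter_val].
HB.instance Definition _ := [Choice of letter by <:].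
HB.instance Definition _ :=
  [SubChoice_isSubOrder of letter by <: with Order.Disp tt tt].

Record letter_upto (n : nat) :=
  LetterUpto { letter_upto_val :> letter; _ : (letter_upto_val <= n)%N }.
HB.instance Definition _ n := [isSub for @letter_upto_val n].
HB.instance Definition _ n := [Choice of letter_upto n by <:].
HB.instance Definition _ n :=
  [SubChoice_isSubOrder of letter_upto n by <: with Order.Disp tt tt].

Notation hypo_rank n := (hypo (letter_upto n)).

Definition l1 : letter_upto 2 := @LetterUpto 2 (@Letter 1 isT) isT.
Definition l2 : letter_upto 2 := @LetterUpto 2 (@Letter 2 isT) isT.

Definition pairs_lt : Type := {p : letter * letter | p.1 < p.2}.

Section Varphi.
Variable p : pairs_lt.
Let i := (val p).1.
Let j := (val p).2.

Definition varphi_letter (a : letter) : hypo_rank 2 :=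
  if a == i then \pi_(hypo_rank 2) [:: l1]
  else if a == j then \pi_(hypo_rank 2) [:: l2]
  else if i < a < j then \pi_(hypo_rank 2) [:: l2; l1]
  else \pi_(hypo_rank 2) [::].

Definition varphi_word (w : seq letter) : hypo_rank 2 :=
  \prod_(a <- w) varphi_letter a.

Lemma varphi_word_monoid_morphism : monoid_morphism varphi_word.
Proof.
by split=> [|u v]; [exact: big_nil | exact: big_cat].
Qed.

Let code (a : letter) : seq (letter_upto 2) :=
  if a == i then [:: l1] else if a == j then [:: l2]
  else if i < a < j then [:: l2; l1] else [::].
Let codes (w : seq letter) := flatten [seq code a | a <- w].

Let varphi_wordE w : varphi_word w = \pi_(hypo_rank 2) (codes w).
Proof.
rewrite /varphi_word; elim: w => [|a w IH]; first by rewrite big_nil.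
rewrite big_cons IH [RHS](hypo_pi_monoid_morphism _).2; congr (_ * _).
by rewrite /varphi_letter /code; do ![case: ifP => _].
Qed.

Let ij : i < j. Proof. exact: (valP p). Qed.

Let mem_codes1 w : {in w, forall a, ~~ (i < a < j)} -> (l1 \in codes w) = (i \in w).
Proof.
elim: w => [//|a w IH] H; rewrite /= mem_cat inE IH => [|b bw]; last first.
  by apply: H; rewrite inE bw orbT.
have /negbTE := H a (mem_head _ _); rewrite /code [i == a]eq_sym => ->.
by case: (a == i); case: (a == j).
Qed.

Let mem_codes2 w : {in w, forall a, ~~ (i < a < j)} -> (l2 \in codes w) = (j \in w).
Proof.
elim: w => [//|a w IH] H; rewrite /= mem_cat inE IH => [|b bw]; last first.
  by apply: H; rewrite inE bw orbT.
have /negbTE := H a (mem_head _ _); rewrite /code => ->.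
by case: (eqVneq a i) => [->|_]; rewrite [j == _]eq_sym ?(lt_eqF ij) //; case: (a == j).
Qed.

Let inv_codes w : {in w, forall a, ~~ (i < a < j)} ->
  subseq [:: l2; l1] (codes w) = subseq [:: j; i] w.
Proof.
elim/last_ind: w => [//|w a IH] H.
have Hw : {in w, forall a, ~~ (i < a < j)}.
  by move=> b bw; apply: H; rewrite mem_rcons inE bw orbT.
have /negbTE Ha : ~~ (i < a < j) by apply: H; rewrite mem_rcons mem_head.
rewrite subseq2_rcons /codes map_rcons flatten_rcons subseq2_cat -/(codes w).
rewrite (IH Hw) (mem_codes2 Hw) /code Ha [i == a]eq_sym.
by case: (a == i); case: (a == j); rewrite //= ?andbT ?andbF ?orbF.
Qed.

Lemma varphi_word_hypo u v : P_hypo u = P_hypo v -> varphi_word u = varphi_word v.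
Proof.
move=> /hypo_novelli[puv H]; rewrite !varphi_wordE; apply/eqP/hypo_piP/hypo_novelli.
split; first exact/perm_flatten/perm_map.
move=> b c [bu cu bc _].
have [-> ->] : b = l1 /\ c = l2.
  case: b c {bu cu} bc => -[[|[|[|b]]] b0] b2 // [[[|[|[|c]]] c0] c2] // bc.
  by split; do 2!apply: val_inj.
case mid : (has (fun a => i < a < j) u).
  have inv w : has (fun a => i < a < j) w -> subseq [:: l2; l1] (codes w).
    move=> /hasP[a aw /andP[ia aj]].
    apply: (@subseq_trans _ (code a)); first by rewrite /code ia aj gt_eqF // lt_eqF.
    case/splitPr: aw => w1 w2; rewrite /codes map_cat flatten_cat /=.
    exact: subseq_trans (prefix_subseq _ _) (suffix_subseq _ _).
  by rewrite !inv // -(perm_has _ puv).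
have Hu : {in u, forall a, ~~ (i < a < j)} by apply/hasPn/negbT.
have Hv : {in v, forall a, ~~ (i < a < j)}.
  by move=> a; rewrite -(perm_mem puv); exact: Hu.
rewrite (inv_codes Hu) (inv_codes Hv).
case iju : ((i \in u) && (j \in u)).
  by have /andP[iu ju] := iju; apply: H; split.
have ijv := iju; rewrite !(perm_mem puv) in ijv.
by rewrite !(contraFF (@subseq2_mem _ _ i j _)).
Qed.

(* Well defined on classes, by varphi_pi below: the choice of repr is immaterial. *)
Definition varphi (x : hypo letter) : hypo_rank 2 := varphi_word (repr x).

Lemma varphi_pi w : varphi (\pi_(hypo letter) w) = varphi_word w.
Proof. by apply: varphi_word_hypo; exact: P_hypo_repr. Qed.

Lemma varphi_monoid_morphism : monoid_morphism varphi.
Proof.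
split=> [|]; first by rewrite [LHS](varphi_pi [::]) varphi_word_monoid_morphism.1.
elim/quotW=> u; elim/quotW=> v.
transitivity (varphi (\pi_(hypo letter) (u ++ v))).
  by congr varphi; exact: hypo_pi_mul.
rewrite !varphi_pi.
exact: varphi_word_monoid_morphism.2.
Qed.

End Varphi.

Definition phi (x : hypo letter) : prodm (fun _ : pairs_lt => hypo_rank 2) :=
  fun p => varphi p x.

(* Main.v *)
(** Since hypoplactic classes are determined by content and inversions between
    consecutive letters of the support, it suffices to recover both from the
    components [varphi_ij].  When no letter of [w] lies strictly between [i] and
    [j], [varphi_ij [w]] is the class of the word obtained from [w] by keeping
    only [i] and [j], renamed 1 and 2; so it determines [|w|_i] and whether [ji]
    is a subsequence of [w].  The pairs [(a, a + 1)] give the content, and the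
    pairs of consecutive letters of the support give the inversions. *)

Require Import Defs.
From HB Require Import structures.
From mathcomp Require Import all_boot all_order.
From mathcomp Require Import boolp.

Set Implicit Arguments.
Unset Strict Implicit.
Unset Printing Implicit Defensive.

Import Order.TTheory.

Local Open Scope order_scope.
Local Open Scope quotient_scope.
Local Open Scope group_scope.

Lemma phi_monoid_morphism : monoid_morphism phi.
Proof.
split=> [|x y]; apply: functional_extensionality_dep => p.
  exact: (varphi_monoid_morphism p).1.
exact: (varphi_monoid_morphism p).2.
Qed.

Section Restriction.
Variable p : pairs_lt.
Let i := (val p).1.
Let j := (val p).2.

(** Letters strictly between [i] and [j] are erased here but sent to the class of 21 by
    [varphi_letter], so the two agree only on words avoiding such letters. *)
Definition keep_letter (a : letter) : option (letter_upto 2) :=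
  if a == i then Some l1 else if a == j then Some l2 else None.

Definition restriction (w : seq letter) : seq (letter_upto 2) :=
  pmap keep_letter w.

Let ji : (j == i) = false.
Proof. exact: (gt_eqF (valP p)). Qed.

Lemma varphi_word_restriction w : {in w, forall a, ~~ (i < a < j)} ->
  varphi_word p w = \pi_(hypo_rank 2) (restriction w).
Proof.
rewrite /varphi_word /restriction.
elim: w => [|a w IH] H; first by rewrite big_nil.
rewrite big_cons {}IH => [|b bw]; last by apply: H; rewrite inE bw orbT.
have {H} /negbTE ij := H a (mem_head _ _); move: ij.
rewrite /varphi_letter /= /keep_letter -/i -/j => ->.
case: (a == i); first exact: hypo_pi_mul.
by case: (a == j); exact: hypo_pi_mul.
Qed.

Lemma count_restriction1 w : count_mem l1 (restriction w) = count_mem i w.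
Proof.
rewrite /restriction; elim: w => [//|a w IH] /=.
by rewrite /keep_letter; case: (eqVneq a i) => [_|_] /=; [|case: (a == j)];
  rewrite /= IH.
Qed.

Lemma count_restriction2 w : count_mem l2 (restriction w) = count_mem j w.
Proof.
rewrite /restriction; elim: w => [//|a w IH] /=.
rewrite /keep_letter; case: (eqVneq a i) => [->|_] /=.
  by rewrite eq_sym ji IH.
by case: (a == j); rewrite /= IH.
Qed.

Lemma mem_restriction1 w : (l1 \in restriction w) = (i \in w).
Proof. by rewrite -!has_pred1 !has_count count_restriction1. Qed.

Lemma mem_restriction2 w : (l2 \in restriction w) = (j \in w).
Proof. by rewrite -!has_pred1 !has_count count_restriction2. Qed.

Lemma inversion_restriction w :
  subseq [:: l2; l1] (restriction w) = subseq [:: j; i] w.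
Proof.
elim: w => [//|a w IH].
(* After a head [j], only an occurrence of [i] in the tail remains to be found; [m1] settles that
   case. *)
have m1 := mem_restriction1 w; rewrite -!sub1seq in m1.
move: IH m1; rewrite /restriction /= /keep_letter eq_sym.
case: (eqVneq i a) => [<-|_] /=; first by rewrite ji => ->.
rewrite [a == j]eq_sym; case: (j == a) => //=.
Qed.

Lemma varphi_word_eqP (u v : seq letter) :
  {in u, forall a, ~~ (i < a < j)} -> {in v, forall a, ~~ (i < a < j)} ->
  varphi_word p u = varphi_word p v ->
  count_mem i u = count_mem i v /\
  (i \in u -> j \in u -> subseq [:: j; i] u = subseq [:: j; i] v).
Proof.
move=> Hu Hv; rewrite !varphi_word_restriction // => /eqP/hypo_piP.
move=> /hypo_novelli[uv inv]; split=> [|iu ju].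
  by rewrite -!count_restriction1; exact: (permP uv).
rewrite -!inversion_restriction; apply: inv; split=> //.
- by rewrite mem_restriction1.
- by rewrite mem_restriction2.
(* [l1] and [l2] are consecutive: the only values in rank 2 are 1 and 2. *)
- by case=> [[[|[|[|x]]] x0] x2].
Qed.

End Restriction.

(** With the successor as [b], the gap condition holds for all words, so contents can be compared
    before the supports are known to agree. *)
Lemma exists_next_letter (a : letter) :
  exists2 b : letter, a < b & forall x : letter, ~~ (a < x < b).
Proof.
exists (@Letter a.+1 isT); first by rewrite ltEsub ltEnat /=.
by move=> x; rewrite !ltEsub !ltEnat /= ltnS ltnNge andNb.
Qed.

Lemma phi_injective : injective phi.
Proof.
elim/quotW=> u; elim/quotW=> v E.
have {}E p : varphi_word p u = varphi_word p v.
  by rewrite -!varphi_pi; exact: (congr1 (fun f => f p) E).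
have uv : perm_eq u v.
  apply/allP => a _ /=; have [b ab nab] := exists_next_letter a; apply/eqP.
  have nab_in (w : seq letter) : {in w, forall x, ~~ (a < x < b)} by move=> x _; exact: nab.
  exact: (varphi_word_eqP (p := exist _ (a, b) ab) (nab_in u) (nab_in v) (E _)).1.
apply/eqP/hypo_piP/hypo_novelli; split=> // b c [bu cu bc nu].
(* Equal contents give equal supports, so the gap between [b] and [c] in [u] is also a gap in
   [v]. *)
have nv x : x \in v -> ~~ (b < x < c) by rewrite -(perm_mem uv); exact: nu.
exact: (varphi_word_eqP (p := exist _ (b, c) bc) nu nv (E _)).2.
Qed.

Theorem proposition3p6 : monoid_morphism phi /\ injective phi.
Proof. exact: (conj phi_monoid_morphism phi_injective). Qed.
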